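(* Let $d\ge2$ be a square-free integer and let $T$ be a minimal interval exchange transformation on $[\ell,r[$ with $\ell$, all separation points $\gamma_i$ and all translation values $\alpha_i$ lying in $\mathbb Z[\sqrt d]$. Then $\Pi(J)\in\Theta(1)$ for every semi-interval $J$ admissible for $T$; that is, there exist constants $0<c\le C$ depending only on $T$ such that $c\le\Pi(J)\le C$ for every semi-interval $J$ admissible for $T$.
   Context: An $s$-interval exchange transformation $T$ on $[\ell,r[$ is given by a finite alphabet $A=\{a_1<_1\cdots<_1a_s\}$ with a second total order $<_2$ and a partition $(I_a)_{a\in A}$ of $[\ell,r[$ into semi-intervals $I_a=[\gamma_a,\mu_a[$ (sets $[\alpha,\beta[=\{z:\alpha\le z<\beta\}$) of lengths $\lambda_a>0$ placed left to right in the order $<_1$; with $\nu_a=\ell+\sum_{b\le_2a}\lambda_b$, $T(z)=z+\alpha_a$ on $I_a$ where $\alpha_a=\nu_a-\mu_a$ are the translation values. Write $\gamma_i=\gamma_{a_i}$ (separation points, $\gamma_1=\ell$). $T$ is minimal if every orbit is dense. For $z=m+n\sqrt d$ with $m,n\in\mathbb Z$ set $\Psi(z)=\max(|m|,|n|)$. For a finite union $X$ of semi-intervals with endpoints in $\mathbb Z[\sqrt d]$, $\Psi(X)=\max\{\Psi(z):z\in\partial X\}$ ($\partial X$ the boundary) and the reduced complexity is $\Pi(X)=|X|\,\Psi(X)$, $|X|$ the Lebesgue measure. Admissibility: for $J=[u,v[$ and $z\in[\ell,r[$ let $\rho^+_{J,T}(z)=\min\{n>0:T^n(z)\in\,]u,v[\}$,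 $\rho^-_{J,T}(z)=\min\{n\ge0:T^{-n}(z)\in\,]u,v[\}$, $E_{J,T}(z)=\{k:-\rho^-_{J,T}(z)\le k<\rho^+_{J,T}(z)\}$, $N_{J,T}(z)=\{T^k(z):k\in E_{J,T}(z)\}$, $\mathrm{Div}(J,T)=\bigcup_{i=1}^sN_{J,T}(\gamma_i)$; $J=[u,v[$ with $\ell\le u<v\le r$ is admissible for $T$ if $u,v\in\mathrm{Div}(J,T)\cup\{r\}$. *)

(* Defs.v *)
From HB Require Import structures.
From mathcomp Require Export all_boot all_order all_algebra.
From mathcomp Require Export all_classical all_reals all_analysis.
From mathcomp Require wochoice.

Set Implicit Arguments.
Unset Strict Implicit.
Unset Printing Implicit Defensive.

Export Order.TTheory GRing.Theory Num.Theory.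
Export numFieldNormedType.Exports.

Local Open Scope classical_set_scope.
Local Open Scope ring_scope.

(* The semi-intervals I_a are determined by the left end point, the lengths
   and the order le1: they are laid out from left to right along le1. *)
Record iet (R : realType) (A : finType) := Iet {
  le1 : rel A;
  le2 : rel A;
  le1_total : wochoice.total_order le1;
  le2_total : wochoice.total_order le2;
  alphabet_gt0 : (0 < #|A|)%N;
  lft : R;
  len : A -> R;
  len_gt0 : forall a, 0 < len a }.

Section IntervalExchange.
Variables (R : realType) (A : finType) (T : iet R A).

Definition rgt : R := lft T + \sum_(a : A) len T a.

Definition iet_dom : set R := `[lft T, rgt[.

(* \gamma_a, \mu_a and \nu_a *)
Definition sep (a : A) : R :=
  lft T + \sum_(b : A | le1 T b a && (b != a)) len T b.
Definition mu (a : A) : R := lft T + \sum_(b : A | le1 T b a) len T b.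
Definition nu (a : A) : R := lft T + \sum_(b : A | le2 T b a) len T b.

Definition trans (a : A) : R := nu a - mu a.

(* The exchange map; the value outside the domain is irrelevant. *)
Definition iet_map (z : R) : R :=
  if [pick a | sep a <= z < mu a] is Some a then z + trans a else z.

Definition iet_inv : R -> R := pinv iet_dom iet_map.

Definition iter_int (k : int) (z : R) : R :=
  match k with
  | Posz n => iter n iet_map z
  | Negz n => iter n.+1 iet_inv z
  end.

Definition iet_orbit (z : R) : set R := range (iter_int ^~ z).

Definition iet_minimal : Prop :=
  forall z, iet_dom z -> iet_dom `<=` closure (iet_orbit z).

(* The minimum of P; arbitrarily 0 if P is empty, which does not happen below
   for a minimal exchange. *)
Definition min_nat (P : set nat) : nat :=
  xget 0%N [set n | P n /\ forall m, P m -> (n <= m)%N].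

Definition rho_plus (u v z : R) : nat :=
  min_nat [set n | (0 < n)%N /\ iter_int n%:Z z \in `]u, v[].

Definition rho_minus (u v z : R) : nat :=
  min_nat [set n | iter_int (- n%:Z) z \in `]u, v[].

Definition Eset (u v z : R) : set int :=
  [set k | - (rho_minus u v z)%:Z <= k < (rho_plus u v z)%:Z].

Definition Nset (u v z : R) : set R := iter_int ^~ z @` Eset u v z.

Definition Div (u v : R) : set R := \bigcup_(a : A) Nset u v (sep a).

Definition admissible (u v : R) : Prop :=
  [/\ lft T <= u, u < v, v <= rgt,
      (Div u v `|` [set rgt]) u & (Div u v `|` [set rgt]) v].

End IntervalExchange.

Definition squarefree (d : nat) : Prop :=
  forall k : nat, (k ^ 2 %| d)%N -> k = 1%N.

Section QuadraticComplexity.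
Variables (R : realType) (d : nat).

Definition quad (p : int * int) : R := p.1%:~R + p.2%:~R * Num.sqrt d%:R.

Definition Zsqrt : set R := range quad.

(* For z in Zsqrt the pair (m, n) is unique when sqrt d is irrational; the
   value for z outside Zsqrt is irrelevant. *)
Definition Psi (z : R) : R :=
  let p := xget (0, 0) [set p | z = quad p] in
  (Num.max `|p.1| `|p.2|)%:~R.

Definition boundary (X : set R) : set R := closure X `\` interior X.

Definition Psi_set (X : set R) : R := sup (Psi @` boundary X).

Definition reduced_complexity (X : set R) : R :=
  fine (lebesgue_measure X) * Psi_set X.

End QuadraticComplexity.

(* Main.v *)
Require Import Defs.
From mathcomp Require Import ring lra zify.

Set Implicit Arguments.
Unset Strict Implicit.
Unset Printing Implicit Defensive.

Local Open Scope classical_set_scope.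
Local Open Scope ring_scope.

(* An element of [Z[sqrt d]] with coefficients bounded by [K] is zero or at
   least of order [1/K], by its norm. Hence [|J| Psi(J)] is bounded below, and
   for the upper bound it suffices that every orbit, forwards and backwards,
   meets [J] within [O(1/|J|)] steps, since each step changes the coefficients
   boundedly. The same separation gives, uniformly in [z] and [n], that
   [|T^n z - z|] is at least [c/n] and that [z] has a one-sided neighbourhood of
   length [c/n] on which [T, ..., T^n] are translations. Pulling such
   neighbourhoods back along an orbit which avoids [J] for [n] steps produces
   disjoint sets of measures [c/i], whose sum grows like a logarithm; this
   forces the first entry into [J] to be within [O(1/n)] of an endpoint of [J].
   Repeating this after each entry, the separation of the orbit makes the times
   of the successive entries grow geometrically, so the middle of [J] could
   never be reached if [n |J|] were large. *)

(** * Hitting times of maps with linearly separated orbits *)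

Lemma sum_disjoint_itv (R : realType) (l r : R) (n : nat) (s e : 'I_n -> R) :
  l <= r -> (forall i, l <= s i) -> (forall i, s i <= e i) ->
  (forall i, e i <= r) ->
  (forall i j y, s i < y < e i -> s j < y < e j -> i = j) ->
  \sum_(i < n) (e i - s i) <= r - l.
Proof.
move=> lr ls se er dis.
pose mu := @lebesgue_measure R.
have muE (x y : R) : x <= y -> mu `]x, y[%classic = (y - x)%:E.
  move=> xy; rewrite /mu lebesgue_measure_itv /= lte_fin.
  by case: ltP => // yx; rewrite (le_anti (introT andP (conj xy yx))) subrr.
pose F i := `](s i), (e i)[%classic.
have Fm i : measurable (F i) by exact: measurable_itv.
have tF : trivIset setT F.
  by apply/trivIsetP => i j _ _; apply: contra_neqP => /eqP/set0P[y [] /=];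
    rewrite /F /= !in_itv /=; apply: dis.
have := measure_bigsetU_ord mu predT Fm tF.
rewrite [RHS](eq_bigr (fun i => (e i - s i)%:E)) => [|i _]; last exact: muE.
rewrite sumEFin => sumE.
have : (mu (\big[setU/set0]_(i < n) F i) <= mu `[l, r]%classic)%E.
  apply: le_measure; [rewrite inE..|].
  - by apply: bigsetU_measurable => i _; exact: Fm.
  - exact: measurable_itv.
  apply: (big_ind (fun X => X `<=` `[l, r]%classic)) => [//|A B sA sB|i _ y].
    by rewrite subUset.
  rewrite /F /= !in_itv /= => /andP[sy ye].
  by rewrite (le_trans (ls _) (ltW sy)) (le_trans (ltW ye) (er _)).
rewrite [leLHS]sumE /mu lebesgue_measure_itv /= lte_fin.
case: ltP => [_|rl]; first by rewrite -EFinB lee_fin.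
by rewrite lee_fin => /le_trans; apply; rewrite subr_ge0.
Qed.

(** Each block [[M, 2M)] has [M] terms, all at least [1/(2M)], and so contributes at least [1/2],
    wherever the sum starts. *)
Lemma harmonic_dyadic (R : realType) (m K : nat) : (0 < m)%N ->
  K%:R / 2 <= \sum_(m <= i < m * 2 ^ K) (i%:R^-1 : R).
Proof.
move=> m0; elim: K => [|K IH]; first by rewrite muln1 big_geq// mul0r.
have le1 : (m <= m * 2 ^ K)%N by rewrite leq_pmulr// expn_gt0.
have le2 : (m * 2 ^ K <= m * 2 ^ K.+1)%N by rewrite leq_mul2l leq_exp2l// leqnSn orbT.
rewrite (big_cat_nat le1 le2) /= -natr1 mulrDl lerD//.
set M := (m * 2 ^ K)%N in le1 le2 *.
have M0 : (0 < M)%N by rewrite (leq_trans m0).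
have -> : (m * 2 ^ K.+1)%N = (M + M)%N by rewrite /M expnS; lia.
have -> : 1 / 2 = \sum_(M <= i < M + M) ((M + M)%:R^-1 : R).
  rewrite sumr_const_nat addnK -[RHS]mulr_natr natrD.
  have : (0 : R) < M%:R by rewrite ltr0n.
  by move=> ?; field; lra.
apply: ler_sum_nat => i /andP[Mi iM].
by rewrite lef_pV2 ?posrE ?ltr0n ?ler_nat ?(ltnW iM)//; lia.
Qed.

(* The interval starts at [z] or ends there: a two-sided neighbourhood of [z]
   need not exist, as [z] may be a discontinuity. *)
Definition local_translation (R : realType) (l r c : R) (f : R -> R) : Prop :=
  forall z n, l <= z < r -> (0 < n)%N -> exists s, [/\ l <= s, s + c / n%:R <= r &
    forall y, s < y < s + c / n%:R -> `|y - z| < c / n%:R /\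
      forall k, (k <= n)%N -> iter k f y = iter k f z + (y - z)].

Definition separated_orbits (R : realType) (l r c : R) (f : R -> R) : Prop :=
  forall z n, l <= z < r -> (0 < n)%N -> c / n%:R <= `|iter n f z - z|.

(** All that the hitting time argument uses about the exchange, isolated so that it also runs for
    the inverse map. *)
Record translation_dynamics (R : realType) (l r c : R) (f : R -> R) : Prop := {
  td_const_gt0 : 0 < c;
  td_lt : l < r;
  td_stable : forall z, l <= z < r -> l <= f z < r;
  td_local : local_translation l r c f;
  td_separated : separated_orbits l r c f }.

Lemma iter_stable (R : realType) (l r : R) (f : R -> R) z n :
  (forall z, l <= z < r -> l <= f z < r) -> l <= z < r -> l <= iter n f z < r.
Proof. by move=> f_stable zI; elim: n => //= n; apply: f_stable. Qed.

(* The point [f^n x] entering the interval pulls back to the points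
   [f^(n-i) x], which have neighbourhoods of length [c/i]; if the entry takes
   place far from both endpoints these are disjoint for [i] of order [n], while
   the sum of the [c/i] is unbounded. *)
Lemma entry_near_endpoint (R : realType) (l r c : R) (f : R -> R) :
  translation_dynamics l r c f -> exists2 C : R, 0 < C &
  forall x a b n, l <= x < r -> l <= a -> b <= r ->
  (forall k, (k < n)%N -> ~ (a < iter k f x < b)) -> a < iter n f x < b ->
  n%:R * (iter n f x - a) <= C \/ n%:R * (b - iter n f x) <= C.
Proof.
move=> [c_gt0 lt_lr f_stable f_loc _].
(* Over [K] dyadic blocks the sum of the [c/i] exceeds [r - l]. *)
pose K := Num.bound (2 * (r - l) / c).
have K_gt : r - l < c * (K%:R / 2).
  have : 2 * (r - l) / c < K%:R.
    by rewrite archi_boundP// divr_ge0 ?mulr_ge0 ?subr_ge0 ?ltW.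
  by rewrite ltr_pdivrMr// => ?; lra.
(* The term [r - l] rules out [n < 2 ^ K]; the term [4 * c] gives [2 c/i <= C/n] for all [i >= m]
   below. *)
pose C : R := 2 ^+ K * ((r - l) + 4 * c).
have P0 : (0 : R) < 2 ^+ K by rewrite exprn_gt0.
exists C => [|x a b n xI la br out enter]; first by rewrite mulr_gt0//; lra.
set q := iter n f x in enter *.
apply: contrapT => /not_orP[/negP + /negP]; rewrite -!ltNge => qa bq.
have n_ge : (2 ^ K <= n)%N.
  rewrite leqNgt; apply/negP => n_lt.
  have nlt : (n%:R : R) < 2 ^+ K by rewrite -natrX ltr_nat.
  have qr : q < r by case/andP: (iter_stable n f_stable xI).
  have qa0 : 0 < q - a by case/andP: enter => ? _; rewrite subr_gt0.
  have : n%:R * (q - a) <= 2 ^+ K * (r - l).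
    by rewrite ler_pM// ?ltW//; lra.
  have : 0 < 2 ^+ K * (4 * c) by rewrite !mulr_gt0.
  by move: qa; rewrite /C mulrDr; lra.
have n_gt0 : (0 < n)%N by rewrite (leq_trans _ n_ge)// expn_gt0.
have nR : (0 : R) < n%:R by rewrite ltr0n.
pose m := (n %/ 2 ^ K)%N.
have m_gt0 : (0 < m)%N by rewrite divn_gt0 ?expn_gt0.
have mK_le : (m * 2 ^ K <= n)%N by exact: leq_divM.
have mK_gt : (n < m.+1 * 2 ^ K)%N by rewrite -ltn_divLR ?expn_gt0.
set M := (m * 2 ^ K)%N in mK_le.
have small i : (m <= i)%N -> 2 * (c / i%:R) <= C / n%:R.
  move=> mi; have i0 : (0 : R) < i%:R by rewrite ltr0n (leq_trans m_gt0).
  have n_le : (n%:R : R) <= 2 * i%:R * 2 ^+ K.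
    rewrite -natrX -!natrM ler_nat (leq_trans (ltnW mK_gt))// leq_mul2r.
    by apply/orP; right; clear -mi m_gt0; lia.
  rewrite mulrA ler_pdivrMr// mulrAC ler_pdivlMr// /C.
  have : 0 <= 2 ^+ K * (r - l) * i%:R by rewrite !mulr_ge0//; lra.
  have : c * n%:R <= c * (2 * i%:R * 2 ^+ K) by rewrite ler_pM2l.
  lra.
have qaC : C / n%:R < q - a by rewrite ltr_pdivrMr// mulrC.
have bqC : C / n%:R < b - q by rewrite ltr_pdivrMr// mulrC.
pose z i := iter (n - i) f x.
have /choice[s sP] : forall i : 'I_(M - m), exists s, [/\ l <= s,
    s + c / (i + m)%:R <= r & forall y, s < y < s + c / (i + m)%:R ->
      `|y - z (i + m)%N| < c / (i + m)%:R /\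
      forall k, (k <= i + m)%N ->
        iter k f y = iter k f (z (i + m)%N) + (y - z (i + m)%N)].
  by move=> i; apply: f_loc; [exact: iter_stable|rewrite addn_gt0 m_gt0 orbT].
(* For a common point [y], the iterate of order [i + m] is within [c/(i+m)] of [q] and within
   [c/(j+m)] of the orbit point at time [n - (j - i)]. That earlier point would then lie in []a,
   b[]. *)
have dis (i j : 'I_(M - m)) y : (i < j)%N ->
    s i < y < s i + c / (i + m)%:R -> s j < y < s j + c / (j + m)%:R -> False.
  move=> ij.
  have [_ _ /(_ y) Hi] := sP i; have [_ _ /(_ y) Hj] := sP j.
  move=> /Hi[di /(_ _ (leqnn _)) fi] /Hj[dj /(_ (i + m)%N) fj].
  have {}fj := fj ltac:(by clear -ij; lia).
  have si := small (i + m)%N (leq_addl _ _).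
  have sj := small (j + m)%N (leq_addl _ _).
  have iM := ltn_ord i; have jM := ltn_ord j.
  move: fi fj; rewrite /z -!iterD subnKC; last by clear -iM mK_le; lia.
  rewrite -/q => -> fj; apply: (out (i + m + (n - (j + m)))%N).
    by clear -ij jM mK_le; lia.
  move: di dj; rewrite /z !ltr_norml => /andP[? ?] /andP[? ?].
  by apply/andP; split; lra.
have sum_le : \sum_(i < M - m) (s i + c / (i + m)%:R - s i) <= r - l.
  apply: sum_disjoint_itv => [||i|i|i j y yi yj]; first exact: ltW.
  - by move=> i; case: (sP i).
  - by rewrite lerDl divr_ge0// ltW.
  - by case: (sP i).
  - apply/val_inj; case: (ltngtP i j) => // [ij|ji].
      by case: (dis i j y).
    by case: (dis j i y).
have := harmonic_dyadic R K m_gt0.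
rewrite -(ler_pM2l c_gt0) mulr_sumr -[m in \sum_(m <= _ < _) _]add0n big_addn.
rewrite big_mkord => sum_ge.
move: sum_le; under eq_bigr do rewrite addrAC subrr add0r.
by move/(le_trans sum_ge); rewrite leNgt K_gt.
Qed.

(** Here [s < t] are the times of two entries on one side and [e] is their distance. The hypotheses
    force [t - s >= (c/C) t], so with [D = C^2/c] the drop from [D/s] to [D/t] is at least [C/t],
    hence at least [e]. *)
Lemma entry_displacement (R : realFieldType) (c C s t e : R) :
  0 < c -> 0 < C -> 0 < s -> s < t -> t * e <= C -> c / (t - s) <= e ->
  e + C ^+ 2 / c / t <= C ^+ 2 / c / s.
Proof.
move=> c0 C0 s0 st te; have t0 := lt_trans s0 st.
have ts0 : 0 < t - s by rewrite subr_gt0.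
rewrite ler_pdivrMr// => ce.
have ct : c * t <= C * (t - s).
  apply: (le_trans (y := t * e * (t - s))); last by rewrite ler_wpM2r// ltW.
  by rewrite -mulrA mulrC ler_wpM2l// ltW.
have cs : c * s <= C * (t - s) by apply: le_trans ct; rewrite ler_pM2l// ltW.
have e_le : e <= C / t by rewrite ler_pdivlMr// mulrC.
rewrite -lerBrDr (le_trans e_le)//.
have -> : C ^+ 2 / c / s - C ^+ 2 / c / t = C / t * (C * (t - s) / (c * s)).
  by field; rewrite !gt_eqF.
apply: ler_peMr; first by rewrite divr_ge0 ?ltW.
by rewrite ler_pdivlMr ?mulr_gt0// mul1r.
Qed.

(* At each successive entry the interval is replaced by the part between the
   entry point and the far endpoint. The entry at time [t] removes at most
   [C/t], and as entries on the same side are [c/(difference of times)] apart,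
   their times grow geometrically; so the total removed is of order [1/n] and
   the middle third survives unless [n] is of order [1/(b - a)]. The potential
   [a' + D/s], [s] being the time of the last entry near the left endpoint,
   encodes this geometric growth. *)
Lemma hitting_time_bound (R : realType) (l r c : R) (f : R -> R) :
  translation_dynamics l r c f -> exists2 C : R, 0 < C &
  forall x a b n m, l <= x < r -> l <= a -> b <= r ->
  (forall k, (k < n)%N -> ~ (a < iter k f x < b)) ->
  a + (b - a) / 3 < iter m f x < b - (b - a) / 3 ->
  n%:R * (b - a) <= C.
Proof.
move=> fT; have [C C0 entry] := entry_near_endpoint fT.
have [c0 lr f_stable _ f_sep] := fT.
pose D := C ^+ 2 / c; pose E := C + D.
have D0 : 0 < D by rewrite divr_gt0 ?exprn_gt0.
have E0 : 0 < E by rewrite addr_gt0.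
exists (3 * E) => [|x a b n m xI la br out hit]; first by rewrite mulr_gt0.
have [->|n_gt0] := posnP n; first by rewrite mul0r mulr_ge0// ltW.
have nR : (0 : R) < n%:R by rewrite ltr0n.
have En0 : 0 < E / n%:R by rewrite divr_gt0.
have n_le_m : (n <= m)%N.
  rewrite leqNgt; apply/negP => /out; apply.
  by case/andP: hit => ? ?; apply/andP; split; lra.
pose left t a' := a' = a \/ exists s, [/\ (n <= s < t)%N, a' = iter s f x &
  a' + D / s%:R <= a + E / n%:R].
pose right t b' := b' = b \/ exists s, [/\ (n <= s < t)%N, b' = iter s f x &
  b - E / n%:R <= b' - D / s%:R].
have leftS t a' : left t a' -> left t.+1 a'.
  by case=> [->|[s [/andP[ns st] ? ?]]]; [left|right; exists s; rewrite ns leqW].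
have rightS t b' : right t b' -> right t.+1 b'.
  by case=> [->|[s [/andP[ns st] ? ?]]]; [left|right; exists s; rewrite ns leqW].
(* The first entry on a side costs at most [C/t <= C/n], and [E = C + D] leaves room for the
   potential [D/t]. *)
have first t e : (n <= t)%N -> t%:R * e <= C -> e + D / t%:R <= E / n%:R.
  move=> nt te; have tR : (0 : R) < t%:R by rewrite ltr0n (leq_trans n_gt0).
  apply: (le_trans (y := E / t%:R)); last first.
    by rewrite ler_pM2l// lef_pV2 ?posrE// ler_nat.
  by rewrite /E mulrDl lerD2r ler_pdivlMr// mulrC.
have next s t e : (n <= s < t)%N -> t%:R * e <= C ->
    e = `|iter t f x - iter s f x| -> e + D / t%:R <= D / s%:R.
  move=> /andP[ns st] te eE; apply: entry_displacement => //.
  - by rewrite ltr0n (leq_trans n_gt0).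
  - by rewrite ltr_nat.
  rewrite eE -natrB ?(ltnW st)// -{2}(subnK (ltnW st)) iterD.
  by apply: f_sep; [exact: iter_stable|rewrite subn_gt0].
(* The induction runs to [m.+1], so that the surviving interval is avoided at time [m] too. *)
have [a' [b' [aa' bb' out' _ _]]] : exists a' b', [/\ a <= a' <= a + E / n%:R,
    b - E / n%:R <= b' <= b, forall k, (k < m.+1)%N -> ~ (a' < iter k f x < b'),
    left m.+1 a' & right m.+1 b'].
  have : (n <= m.+1)%N by exact: leqW.
  elim: m.+1 => [|t IH].
    by rewrite leqn0 => /eqP n0; rewrite n0 in n_gt0.
  rewrite leq_eqVlt => /predU1P[<-|].
    by exists a, b; split=> //; [apply/andP; split; lra..|left|left].
  rewrite ltnS => nt.
  have [a' [b' [/andP[aa' a'E] /andP[b'E bb'] out' la' rb']]] := IH nt.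
  have tR : (0 : R) < t%:R by rewrite ltr0n (leq_trans n_gt0).
  have Dt : 0 < D / t%:R by rewrite divr_gt0.
  have [/andP[a'q qb']|nin] := pselect (a' < iter t f x < b'); last first.
    exists a', b'; split; [by rewrite aa'|by rewrite b'E| |exact: leftS|exact: rightS].
    move=> k; rewrite ltnS leq_eqVlt => /predU1P[->//|]; exact: out'.
  have := entry x a' b' t xI (le_trans la aa') (le_trans bb' br) out'.
  rewrite a'q qb' => /(_ isT)[te|te].
    have q_le : iter t f x + D / t%:R <= a + E / n%:R.
      case: la' => [a'a|[s [st a's a'P]]].
        by have := first t _ nt te; rewrite a'a; lra.
      have : iter t f x - a' = `|iter t f x - iter s f x|.
        by rewrite -a's gtr0_norm// subr_gt0.
      by move/(next s t _ st te); lra.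
    exists (iter t f x), b'; split; [by apply/andP; split; lra|by rewrite b'E| | |].
    - move=> k; rewrite ltnS leq_eqVlt => /predU1P[->|/out' no /andP[qk kb]].
        by rewrite ltxx.
      by apply: no; rewrite kb (lt_trans a'q).
    - by right; exists t; split=> //; rewrite nt ltnSn.
    - exact: rightS.
  have q_ge : b - E / n%:R <= iter t f x - D / t%:R.
    case: rb' => [b'b|[s [st b's b'P]]].
      by have := first t _ nt te; rewrite b'b; lra.
    have : b' - iter t f x = `|iter t f x - iter s f x|.
      by rewrite -b's ltr0_norm ?subr_lt0// opprB.
    by move/(next s t _ st te); lra.
  exists a', (iter t f x); split; [by rewrite aa'|by apply/andP; split; lra| | |].
  - move=> k; rewrite ltnS leq_eqVlt => /predU1P[->|/out' no /andP[ak kq]].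
      by rewrite ltxx andbF.
    by apply: no; rewrite ak (lt_trans kq).
  - exact: leftS.
  - by right; exists t; split=> //; rewrite nt ltnSn.
have : (b - a) / 3 <= E / n%:R.
  rewrite leNgt; apply/negP => lt_E; apply: (out' m (ltnSn m)).
  move: aa' bb' hit => /andP[? ?] /andP[? ?] /andP[? ?].
  by apply/andP; split; lra.
by rewrite ler_pdivlMr//; lra.
Qed.

Lemma iter_cancel (R : realType) (l r : R) (f g : R -> R) z k n :
  (forall z, l <= z < r -> l <= f z < r) -> (forall z, l <= z < r -> g (f z) = z) ->
  l <= z < r -> (k <= n)%N -> iter k g (iter n f z) = iter (n - k) f z.
Proof.
move=> f_stable fK zI; elim: k => [|k IH] kn; first by rewrite subn0.
rewrite iterS (IH (ltnW kn)) -(prednK (n := n - k)) ?subn_gt0// iterS fK.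
  by rewrite subnS.
exact: iter_stable.
Qed.

(** With [w = iter n g z], the map [f^n] translates the neighbourhood of [w] by [z - w], and the
    translate serves for [g] at [z]. Separation is that of [f] at [w]. *)
Lemma translation_dynamics_inverse (R : realType) (l r c : R) (f g : R -> R) :
  translation_dynamics l r c f ->
  (forall z, l <= z < r -> l <= g z < r) ->
  (forall z, l <= z < r -> g (f z) = z) -> (forall z, l <= z < r -> f (g z) = z) ->
  translation_dynamics l r c g.
Proof.
move=> [c0 lr f_stable f_loc f_sep] g_stable fK gK; split=> // z n zI n0.
  have wI := iter_stable n g_stable zI.
  have fw : iter n f (iter n g z) = z by rewrite (iter_cancel g_stable)// subnn.
  set w := iter n g z in wI fw.
  have [s [ls sr sP]] := f_loc w n wI n0.
  have cn0 : 0 < c / n%:R by rewrite divr_gt0// ltr0n.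
  have image y : s < y - z + w < s + c / n%:R -> [/\ l <= y < r,
      `|y - z| < c / n%:R & forall k, (k <= n)%N -> iter k g y = iter k g z + (y - z)].
    move=> yI; have [dist tr] := sP _ yI.
    have y'I : l <= y - z + w < r by case/andP: yI => ? ?; apply/andP; split; lra.
    have fy : iter n f (y - z + w) = y by rewrite tr// fw; lra.
    split=> [||k kn]; first by rewrite -fy iter_stable.
      by rewrite (_ : y - z = y - z + w - w)//; lra.
    rewrite -{1}fy -{2}fw !(iter_cancel f_stable)// tr ?leq_subr//; lra.
  case/andP: zI => lz zr; exists (s + z - w); split.
  (* A part of the translate outside [[l, r]] would contain an iterate of a point of the domain. *)
  - rewrite leNgt; apply/negP => lt_l.
    pose e := Num.min (l - (s + z - w)) (c / n%:R).
    have e0 : 0 < e by rewrite lt_min cn0 subr_gt0 lt_l.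
    have e1 : e <= l - (s + z - w) by rewrite ge_min lexx.
    have e2 : e <= c / n%:R by rewrite ge_min lexx orbT.
    have [|/andP[ly _] _ _] := image (s + z - w + e / 2); last by lra.
    by apply/andP; split; lra.
  - rewrite leNgt; apply/negP => lt_r.
    pose e := Num.min (s + z - w + c / n%:R - r) (c / n%:R).
    have e0 : 0 < e by rewrite lt_min cn0 subr_gt0 lt_r.
    have e1 : e <= s + z - w + c / n%:R - r by rewrite ge_min lexx.
    have e2 : e <= c / n%:R by rewrite ge_min lexx orbT.
    have [|/andP[_ yr] _ _] := image (s + z - w + c / n%:R - e / 2); last by lra.
    by apply/andP; split; lra.
  - move=> y /andP[sy ys]; have [|_ ? ?] := image y; last by [].
    by apply/andP; split; lra.
rewrite -{2}(_ : iter n f (iter n g z) = z) 1?distrC.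
  by apply: f_sep => //; exact: iter_stable.
by rewrite (iter_cancel g_stable)// subnn.
Qed.

(** [hitting_time_bound] presupposes some hit of the middle third. Density of two-sided orbits
    supplies one, once backward hits are turned into forward hits. *)
Lemma hitting_time_le (R : realType) (l r c : R) (f g : R -> R) :
  translation_dynamics l r c f ->
  (forall z, l <= z < r -> l <= g z < r) ->
  (forall z, l <= z < r -> g (f z) = z) -> (forall z, l <= z < r -> f (g z) = z) ->
  (forall x a b, l <= x < r -> l <= a -> a < b -> b <= r ->
    exists m, a < iter m f x < b \/ a < iter m g x < b) ->
  exists2 C : R, 0 < C & forall x a b, l <= x < r -> l <= a -> a < b -> b <= r ->
    exists2 m, a < iter m f x < b & m%:R * (b - a) <= C.
Proof.
move=> fT g_stable fK gK dense.
have gT := translation_dynamics_inverse fT g_stable fK gK.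
have f_stable := td_stable fT.
have [C C0 f_bound] := hitting_time_bound fT.
have [C' C'0 g_bound] := hitting_time_bound gT.
(* If the forward orbit of [x] missed an interval, its backward orbit would hit
   it, and from [f^N x] the map [g] would need more than [N] steps. *)
have hit x a b : l <= x < r -> l <= a -> a < b -> b <= r ->
    exists m, a < iter m f x < b.
  move=> xI la ab br; apply: contrapT => /forallNP miss.
  have [m []] : exists m, a + (b - a) / 3 < iter m f x < b - (b - a) / 3 \/
      a + (b - a) / 3 < iter m g x < b - (b - a) / 3 by apply: dense => //; lra.
    by move=> /andP[? ?]; apply: (miss m); apply/andP; split; lra.
  move=> hitm.
  pose N := Num.bound (C' / (b - a)).
  have : C' / (b - a) < N%:R by rewrite archi_boundP// divr_ge0 ?subr_ge0 ?ltW.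
  rewrite ltr_pdivrMr ?subr_gt0// ltNge => /negP; apply.
  apply: (g_bound (iter N f x) a b N (m + N)%N) => //; first exact: iter_stable.
    by move=> k kN; rewrite (iter_cancel f_stable) ?(ltnW kN)//; exact: miss.
  by rewrite iterD (iter_cancel f_stable)// subnn.
exists C => // x a b xI la ab br.
have /ex_minnP[n hitn n_min] := hit x a b xI la ab br.
exists n => //.
have [m hitm] : exists m, a + (b - a) / 3 < iter m f x < b - (b - a) / 3.
  by apply: hit => //; lra.
apply: f_bound hitm => // k kn; apply/negP; apply: contraL kn => /n_min.
by rewrite -leqNgt.
Qed.

(** * Quadratic integers *)

Section QuadraticIntegers.
Variables (R : realType) (d : nat).

Lemma quadD p q : quad R d (p.1 + q.1, p.2 + q.2) = quad R d p + quad R d q.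
Proof. by rewrite /quad /= !rmorphD /=; ring. Qed.

Lemma quadN p : quad R d (- p.1, - p.2) = - quad R d p.
Proof. by rewrite /quad /= !rmorphN /=; ring. Qed.

(** Membership in [Z[sqrt d]] with [Psi] at most [K], in a form that adds up without uniqueness of
    the coefficients. *)
Definition quad_le (K : nat) (z : R) : Prop := exists p : int * int,
  [/\ z = quad R d p, (`|p.1| <= K)%N & (`|p.2| <= K)%N].

Lemma Zsqrt_quad_le z : Zsqrt d z -> exists K, quad_le K z.
Proof.
move=> [p _ <-]; exists (maxn `|p.1| `|p.2|), p.
by rewrite leq_maxl leq_maxr.
Qed.

Lemma quad_le0 : quad_le 0 0.
Proof. by exists (0, 0); rewrite /quad /= mul0r addr0. Qed.

Lemma quad_leW K L z : (K <= L)%N -> quad_le K z -> quad_le L z.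
Proof. by move=> KL [p [zE p1 p2]]; exists p; rewrite (leq_trans p1) ?(leq_trans p2). Qed.

Lemma quad_leN K z : quad_le K z -> quad_le K (- z).
Proof. by move=> [p [-> p1 p2]]; exists (- p.1, - p.2); rewrite quadN /= !abszN. Qed.

Lemma quad_leD K L z w : quad_le K z -> quad_le L w -> quad_le (K + L) (z + w).
Proof.
move=> [p [-> p1 p2]] [q [-> q1 q2]]; exists (p.1 + q.1, p.2 + q.2).
by rewrite quadD; split=> //=; lia.
Qed.

Lemma quad_leB K L z w : quad_le K z -> quad_le L w -> quad_le (K + L) (z - w).
Proof. by move=> Kz /quad_leN; apply: quad_leD. Qed.

Hypotheses (d_ge2 : (2 <= d)%N) (d_sqf : squarefree d).

(** Irrationality of [sqrt d]: for [n > 0], [n] divides [m], so [d] is a square [k ^ 2], and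
    square-freeness gives [d = 1]. *)
Lemma sqr_eq_squarefree_mul (m n : nat) : (m ^ 2 = d * n ^ 2)%N -> n = 0%N.
Proof.
move=> mE; apply/eqP; rewrite -leqn0 leqNgt; apply/negP => n0.
have /dvdnP[k kE] : (n %| m)%N by rewrite -(dvdn_pexp2r n m (k := 2))// mE dvdn_mull.
move: mE; rewrite kE expnMn => /eqP; rewrite eqn_pmul2r ?expn_gt0 ?n0// => /eqP kd.
have k1 : k = 1%N by apply: d_sqf; rewrite kd.
by move: d_ge2; rewrite -kd k1.
Qed.

Lemma quad_norm (p : int * int) :
  (p.1 ^+ 2 - d%:Z * p.2 ^+ 2)%:~R = quad R d p * quad R d (p.1, - p.2).
Proof.
rewrite /quad /= rmorphB rmorphM !expr2 !rmorphM /= rmorphN /= -pmulrn.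
have := sqr_sqrtr (ler0n R d); set s := Num.sqrt _ => <-; ring.
Qed.

Lemma quad_norm_neq0 (p : int * int) :
  p != (0, 0) -> p.1 ^+ 2 - d%:Z * p.2 ^+ 2 != 0.
Proof.
apply: contraNN; rewrite subr_eq0 => /eqP pE.
have p20 : `|p.2|%N = 0%N.
  apply: (@sqr_eq_squarefree_mul `|p.1|%N); move/(congr1 absz): pE.
  by rewrite abszM !abszX.
have /eqP p2 : p.2 == 0 by rewrite -absz_eq0 p20.
move: pE; rewrite p2 expr0n mulr0 => /eqP; rewrite sqrf_eq0 => /eqP p1.
by rewrite [p]surjective_pairing p1 p2.
Qed.

Lemma quad_eq0 p : quad R d p = 0 -> p = (0, 0).
Proof.
move=> p0; apply/eqP; apply: contraT => /quad_norm_neq0.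
by rewrite -(intr_eq0 R) quad_norm p0 mul0r eqxx.
Qed.

Lemma quad_inj : injective (quad R d).
Proof.
move=> p q pq; have := quad_eq0 (p := (p.1 - q.1, p.2 - q.2)).
have := quadD p (- q.1, - q.2); rewrite quadN pq subrr /= => -> /(_ erefl) [].
move=> /eqP; rewrite subr_eq0 => /eqP p1 /eqP; rewrite subr_eq0 => /eqP p2.
by rewrite [p]surjective_pairing [q]surjective_pairing p1 p2.
Qed.

(** The norm of [z] is a nonzero integer, and the conjugate of [z] is at most [K (1 + sqrt d)]. *)
Lemma quad_le_norm K z : quad_le K z -> z != 0 ->
  1 <= `|z| * (K%:R * (1 + Num.sqrt d%:R)).
Proof.
move=> [p [-> p1 p2]] z0.
have pn0 : p != (0, 0).
  by apply: contra_neq z0 => ->; rewrite /quad /= mul0r addr0.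
have : 1 <= `|(p.1 ^+ 2 - d%:Z * p.2 ^+ 2)%:~R| :> R.
  by rewrite -intr_norm ler1z -gtz0_ge1 normr_gt0 quad_norm_neq0.
rewrite quad_norm normrM => /le_trans; apply; rewrite ler_wpM2l//.
have s0 : 0 <= Num.sqrt (d%:R : R) by exact: sqrtr_ge0.
have le_int (m : int) : (`|m| <= K)%N -> `|m%:~R| <= K%:R :> R.
  by move=> mK; rewrite -intr_norm -abszE -pmulrn ler_nat.
rewrite /quad /= (le_trans (ler_normD _ _))// normrM (ger0_norm s0) mulrDr mulr1.
by rewrite lerD ?ler_wpM2r ?le_int// abszN.
Qed.

Lemma Psi_quad p : Psi d (quad R d p) = (maxn `|p.1| `|p.2|)%:R.
Proof.
rewrite /Psi (_ : xget _ _ = p); last first.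
  by apply: xget_unique => // q /quad_inj ->.
by rewrite -!abszE pmulrn /Num.max /maxn ltz_nat; case: ifP.
Qed.

Lemma Psi_le K z : quad_le K z -> Psi d z <= K%:R.
Proof. by move=> [p [-> p1 p2]]; rewrite Psi_quad ler_nat geq_max p1. Qed.

Lemma quad_le_Psi z : Zsqrt d z -> exists2 K, quad_le K z & Psi d z = K%:R.
Proof.
move=> [p _ <-]; exists (maxn `|p.1| `|p.2|); last by rewrite Psi_quad.
by exists p; rewrite leq_maxl leq_maxr.
Qed.

End QuadraticIntegers.

(** * Reduced complexity of a semi-interval *)

Lemma boundary_itvco (R : realType) (u v : R) : u < v ->
  boundary `[u, v[%classic = [set u; v].
Proof.
move=> uv; rewrite /boundary interior_itv_bnd.
have -> : closure `[u, v[%classic = `[u, v]%classic.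
  have clE : closure `]u, v[%classic = `[u, v]%classic.
    (* The open interval is a ball about its midpoint, so its closure is the closed ball. *)
    have uE : (u + v) / 2 - (v - u) / 2 = u by lra.
    have vE : (u + v) / 2 + (v - u) / 2 = v by lra.
    have uvE : `]u, v[%classic = ball ((u + v) / 2) ((v - u) / 2) :> set R.
      by rewrite ball_itv uE vE.
    rewrite uvE closure_ballE closed_ball_itv; last by rewrite divr_gt0 ?subr_gt0.
    by rewrite uE vE.
  apply/seteqP; split.
    rewrite [X in _ `<=` X](closure_id _).1; last exact: itv_closed.
    by apply: closure_subset => y /=; rewrite !in_itv /= => /andP[-> /ltW].
  rewrite -clE; apply: closure_subset => y /=; rewrite !in_itv /=.
  by move=> /andP[/ltW -> ->].
apply/seteqP; split=> y /=; rewrite !in_itv /=.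
  move=> [/andP[uy yv] /negP]; rewrite negb_and -!leNgt => /orP[yu|vy].
    by left; apply/eqP; rewrite eq_le yu.
  by right; apply/eqP; rewrite eq_le yv.
by move=> [->|->]; rewrite ltxx ?andbF lexx ltW.
Qed.

Lemma reduced_complexity_itvco (R : realType) (d : nat) (u v : R) : u < v ->
  reduced_complexity d `[u, v[ = (v - u) * Num.max (Psi d u) (Psi d v).
Proof.
move=> uv; rewrite /reduced_complexity lebesgue_measure_itv /= lte_fin uv -EFinB /=.
congr (_ * _); rewrite /Psi_set boundary_itvco// image_setU !image_set1.
have sup_le2 (a b : R) : a <= b -> sup ([set a] `|` [set b]) = b.
  move=> ab; rewrite sup_setU ?sup1 => [//||_ _ -> ->//].
  by split; [exists b|exists b => _ ->].
case: (leP (Psi d u) (Psi d v)) => [/sup_le2//|/ltW].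
by rewrite setUC => /sup_le2.
Qed.

(** * Geometry of interval exchanges *)

Section OrderedTiling.
Variables (R : realType) (A : finType) (len : A -> R) (le : rel A) (l : R).

(** Taken with [le1] the tiles are the exchanged intervals, with [le2] their images. *)
Definition tile_start (a : A) : R := l + \sum_(b | le b a && (b != a)) len b.
Definition tile_end (a : A) : R := l + \sum_(b | le b a) len b.

Hypotheses (len_gt0 : forall a, 0 < len a) (le_total : wochoice.total_order le).

Let le_refl : reflexive le. Proof. by case: le_total => [[[]]]. Qed.
Let le_trans : transitive le. Proof. by case: le_total => [[[]]]. Qed.
Let le_anti : antisymmetric le. Proof. by case: le_total => [[]]. Qed.
Let le_tot : total le. Proof. by case: le_total. Qed.

Lemma sum_len_subset (P Q : pred A) : (forall b, P b -> Q b) ->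
  \sum_(b | P b) len b <= \sum_(b | Q b) len b.
Proof.
move=> PQ; rewrite big_mkcond [leRHS]big_mkcond; apply: ler_sum => b _.
by have := PQ b; case: (P b) => [->//|_]; case: (Q b) => //; exact: ltW.
Qed.

Lemma tile_endE a : tile_end a = tile_start a + len a.
Proof. by rewrite /tile_end (bigD1 a) ?le_refl //= (addrC (len a)) addrA. Qed.

Lemma tile_start_lt_end a : tile_start a < tile_end a.
Proof. by rewrite tile_endE ltrDl. Qed.

Lemma tile_start_ge a : l <= tile_start a.
Proof. by rewrite lerDl sumr_ge0// => b _; exact: ltW. Qed.

Lemma tile_end_le a : tile_end a <= l + \sum_b len b.
Proof. by rewrite lerD2l; apply: sum_len_subset. Qed.

Lemma tile_end_le_start a b : le a b -> a != b -> tile_end a <= tile_start b.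
Proof.
move=> ab ne; rewrite lerD2l; apply: sum_len_subset => c ca.
rewrite (le_trans ca ab); apply: contraNneq ne => cb.
by apply/eqP/le_anti; rewrite ab -cb ca.
Qed.

Lemma tile_unique z a b : tile_start a <= z < tile_end a ->
  tile_start b <= z < tile_end b -> a = b.
Proof.
move=> /andP[za az] /andP[zb bz]; apply/eqP; apply: contraT => ne.
have [ab|ba] := orP (le_tot a b).
  by have := tile_end_le_start ab ne; lra.
by rewrite eq_sym in ne; have := tile_end_le_start ba ne; lra.
Qed.

(** The successor is the letter not below [a] with least [tile_end]: the letters strictly before it
    are exactly those below [a]. *)
Lemma tile_next a :
  tile_end a = l + \sum_b len b \/ exists b, tile_start b = tile_end a.
Proof.
have [/existsP[b0 nb0]|/existsPn all] := boolP [exists b, ~~ le b a]; last first.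
  by left; congr (_ + _); apply: eq_bigl => b; have := all b; rewrite negbK.
right; case: (@arg_minP _ _ _ b0 (fun b => ~~ le b a) tile_end nb0) => b nba b_min; exists b.
congr (_ + _); apply: eq_bigl => c; apply/andP/idP => [[cb ne]|ca].
  apply: contraT => nca; have : tile_end b <= tile_end c by exact: b_min.
  rewrite leNgt.
  by rewrite (le_lt_trans (tile_end_le_start cb ne) (tile_start_lt_end b)).
have ab : le a b by have /orP[//|ba] := le_tot a b; rewrite ba in nba.
by split; [exact: le_trans ab|apply: contraNneq nba => <-].
Qed.

Lemma tile_last (a0 : A) : exists a, tile_end a = l + \sum_b len b.
Proof.
case: (@arg_maxP _ _ _ a0 predT tile_end isT) => a _ a_max; exists a.
have [//|[b ba]] := tile_next a.
by have : tile_end b <= tile_end a by [exact: a_max]; rewrite -ba leNgt tile_start_lt_end.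
Qed.

Lemma tile_first (a0 : A) : exists a, tile_start a = l.
Proof.
case: (@arg_minP _ _ _ a0 predT tile_end isT) => a _ a_min; exists a.
rewrite /tile_start big_pred0 ?addr0// => c; apply/negP => /andP[ca ne].
have : tile_end a <= tile_end c by exact: a_min.
rewrite leNgt.
by rewrite (le_lt_trans (tile_end_le_start ca ne) (tile_start_lt_end a)).
Qed.

Lemma tile_cover (a0 : A) z : l <= z < l + \sum_b len b ->
  exists a, tile_start a <= z < tile_end a.
Proof.
move=> /andP[lz zr]; have [a1 a1l] := tile_first a0.
have a1z : tile_start a1 <= z by rewrite a1l.
case: (@arg_maxP _ _ _ a1 (fun a => tile_start a <= z) tile_start a1z).
move=> a az a_max; exists a; rewrite az ltNge.
apply/negP => za; have [aE|[b ba]] := tile_next a; first lra.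
have : tile_start b <= tile_start a by apply: a_max; rewrite ba.
by rewrite ba leNgt tile_start_lt_end.
Qed.

End OrderedTiling.

Section Exchange.
Variables (R : realType) (A : finType) (T : iet R A).

Let a0 : A. Proof. by have /card_gt0P/sigW[a _] := alphabet_gt0 T; exact: a. Qed.

Lemma sepE a : sep T a = tile_start (len T) (le1 T) (lft T) a. Proof. by []. Qed.
Lemma muE a : mu T a = tile_end (len T) (le1 T) (lft T) a. Proof. by []. Qed.
Lemma nuE a : nu T a = tile_end (len T) (le2 T) (lft T) a. Proof. by []. Qed.

(** A tile has the same length in both layouts, so the translation can be read at left ends too. *)
Lemma transE a : trans T a = tile_start (len T) (le2 T) (lft T) a - sep T a.
Proof.
by rewrite /trans muE nuE !tile_endE ?sepE; [lra|exact: le1_total|exact: le2_total].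
Qed.

Lemma sep_lt_mu a : sep T a < mu T a.
Proof. exact: tile_start_lt_end (len_gt0 T) (le1_total T) a. Qed.

Lemma lft_le_sep a : lft T <= sep T a.
Proof. exact: tile_start_ge (len_gt0 T) a. Qed.

Lemma mu_le_rgt a : mu T a <= rgt T.
Proof. exact: tile_end_le (len_gt0 T) a. Qed.

Lemma sep_in_dom a : lft T <= sep T a < rgt T.
Proof. by rewrite lft_le_sep (lt_le_trans (sep_lt_mu a) (mu_le_rgt a)). Qed.

Lemma lft_lt_rgt : lft T < rgt T.
Proof. by have /andP[] := sep_in_dom a0; exact: le_lt_trans. Qed.

Lemma mu_next a : mu T a = rgt T \/ exists b, sep T b = mu T a.
Proof. exact: tile_next (len_gt0 T) (le1_total T) a. Qed.

Lemma nu_last : exists a, nu T a = rgt T.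
Proof. exact: tile_last (len_gt0 T) (le2_total T) a0. Qed.

Lemma iet_cover z : lft T <= z < rgt T -> exists a, sep T a <= z < mu T a.
Proof. exact: (tile_cover (len_gt0 T) (le1_total T) a0). Qed.

Lemma iet_mapE a z : sep T a <= z < mu T a -> iet_map T z = z + trans T a.
Proof.
move=> za; rewrite /iet_map; case: pickP => [b zb|/(_ a)]; last by rewrite za.
by rewrite (tile_unique (len_gt0 T) (le1_total T) za zb).
Qed.

Lemma iet_map_image a z : sep T a <= z < mu T a ->
  tile_start (len T) (le2 T) (lft T) a <= iet_map T z < nu T a.
Proof.
move=> za; rewrite (iet_mapE za); move: za => /andP[? ?].
have := transE a; have : trans T a = nu T a - mu T a by [].
by move=> ? ?; apply/andP; split; lra.
Qed.

Lemma iet_map_stable z : lft T <= z < rgt T -> lft T <= iet_map T z < rgt T.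
Proof.
move=> /iet_cover[a /iet_map_image /andP[lz zr]].
rewrite (le_trans (tile_start_ge (le2 T) (lft T) (len_gt0 T) a) lz).
by rewrite (lt_le_trans zr)//; exact: tile_end_le (len_gt0 T) a.
Qed.

Lemma iet_domE z : iet_dom T z = (lft T <= z < rgt T) :> Prop.
Proof. by rewrite /iet_dom /= in_itv. Qed.

Lemma iet_map_inj : {in iet_dom T &, injective (iet_map T)}.
Proof.
move=> y z; rewrite !inE !iet_domE => /iet_cover[a ya] /iet_cover[b zb] yz.
have := iet_map_image ya; have := iet_map_image zb; rewrite -yz => zi yi.
have ab := tile_unique (len_gt0 T) (le2_total T) yi zi.
by move: yz; rewrite (iet_mapE ya) (iet_mapE zb) -ab => /addIr.
Qed.

Lemma iet_map_surj : set_surj (iet_dom T) (iet_dom T) (iet_map T).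
Proof.
move=> z; rewrite iet_domE => /(tile_cover (len_gt0 T) (le2_total T) a0)[a].
move=> /andP[az za].
have tE := transE a; have tE' : trans T a = nu T a - mu T a by [].
have ya : sep T a <= z - trans T a < mu T a.
  by apply/andP; split; [lra|rewrite -nuE in za; lra].
exists (z - trans T a); last by rewrite (iet_mapE ya) subrK.
have := lft_le_sep a; have := mu_le_rgt a; move: ya => /andP[? ?] ? ?.
by rewrite iet_domE; apply/andP; split; lra.
Qed.

Lemma iet_mapK z : lft T <= z < rgt T -> iet_inv T (iet_map T z) = z.
Proof. by move=> zI; apply: (pinvKV _ iet_map_inj); rewrite inE iet_domE. Qed.

Lemma iet_invK z : lft T <= z < rgt T -> iet_map T (iet_inv T z) = z.
Proof. by move=> zI; apply: (surjpK _ iet_map_surj); rewrite inE iet_domE. Qed.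

Lemma iet_inv_stable z : lft T <= z < rgt T -> lft T <= iet_inv T z < rgt T.
Proof.
rewrite -!iet_domE => /iet_map_surj[y]; rewrite iet_domE => yI <-.
by rewrite iet_mapK// iet_domE.
Qed.

End Exchange.

(** * Minimal exchanges and growth of coefficients along orbits *)

Section Dynamics.
Variables (R : realType) (A : finType) (T : iet R A).
Local Notation f := (iet_map T).
Local Notation g := (iet_inv T).

Lemma iet_minimal_hit x a b : iet_minimal T ->
  lft T <= x < rgt T -> lft T <= a -> a < b -> b <= rgt T ->
  exists m, a < iter m f x < b \/ a < iter m g x < b.
Proof.
move=> Tmin xI la ab br.
have : closure (iet_orbit T x) ((a + b) / 2).
  by apply: Tmin; rewrite iet_domE//; apply/andP; split; lra.
have ab_nbhs : nbhs ((a + b) / 2) `]a, b[%classic.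
  by apply: open_nbhs_nbhs; split; [exact: itv_open|rewrite /= in_itv /=; apply/andP; split; lra].
move=> /(_ _ ab_nbhs)[_ [[[m|m] _ <-] /=]]; rewrite in_itv /= => hit.
  by exists m; left.
by exists m.+1; right.
Qed.

Lemma open_itv_avoid (s : seq R) (a b : R) : a < b -> exists a' b',
  [/\ a <= a', a' < b', b' <= b & forall y, y \in s -> ~ (a' < y < b')].
Proof.
elim: s => [|y s IH] ab; first by exists a, b; split.
have [a' [b' [aa' ab' bb' out]]] := IH ab.
have [/andP[a'y yb']|nin] := pselect (a' < y < b'); last first.
  by exists a', b'; split=> // z; rewrite inE => /predU1P[->|/out].
exists a', y; split=> // [|z]; first exact: le_trans (ltW yb') bb'.
rewrite inE => /predU1P[->|/out nz]; first by rewrite ltxx andbF.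
by move=> /andP[az zy]; apply: nz; rewrite az (lt_trans zy).
Qed.

(** A periodic point has a finite two-sided orbit, which misses some open interval. *)
Lemma iet_minimal_aperiodic z n : iet_minimal T ->
  lft T <= z < rgt T -> (0 < n)%N -> iter n f z <> z.
Proof.
move=> Tmin zI n0 fz.
have fmul m : iter (m * n) f z = z by elim: m => //= m IH; rewrite mulSn iterD IH.
have fmod m : iter m f z = iter (m %% n) f z.
  by rewrite {1}(divn_eq m n) addnC iterD fmul.
have [a [b [la ab br out]]] := open_itv_avoid [seq iter k f z | k <- iota 0 n] (lft_lt_rgt T).
have {}out m : ~ (a < iter m f z < b).
  by rewrite fmod; apply: out; apply: map_f; rewrite mem_iota ltn_mod n0.
have [m [/out//|]] := iet_minimal_hit Tmin zI la ab br.
(* On a cycle, going back [m] steps amounts to going forward [m * n - m] steps. *)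
have -> : iter m g z = iter (m * n - m) f z; last exact: out.
rewrite -[in LHS](fmul m) (iter_cancel (@iet_map_stable _ _ T) (@iet_mapK _ _ T))//.
by rewrite leq_pmulr.
Qed.

(** The letter [b] last for [le2] has [trans b = rgt - mu b]. If [mu b = rgt], then [sep b] is a
    fixed point, against aperiodicity; otherwise [mu b] is a separation point. *)
Lemma rgt_Zsqrt d : iet_minimal T -> (forall a, Zsqrt d (sep T a)) ->
  (forall a, Zsqrt d (trans T a)) -> Zsqrt d (rgt T).
Proof.
move=> Tmin sepZ transZ; have [b nub] := nu_last T.
have tb : trans T b = rgt T - mu T b by rewrite /trans nub.
have [mub|[c sc]] := mu_next T b.
  have := iet_minimal_aperiodic Tmin (sep_in_dom T b) (ltn0Sn 0).
  by rewrite /= (@iet_mapE _ _ _ b) ?lexx ?sep_lt_mu// tb mub subrr addr0.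
have -> : rgt T = trans T b + sep T c by rewrite tb sc; lra.
have [p _ <-] := transZ b; have [q _ <-] := sepZ c; rewrite -quadD; exact: imageP.
Qed.

Variable d : nat.

Lemma quad_le_iter D z n : (forall a, quad_le d D (trans T a)) ->
  lft T <= z < rgt T -> quad_le d (n * D) (iter n f z - z).
Proof.
move=> transD zI; elim: n => [|n IH]; first by rewrite subrr; exact: quad_le0.
have [a za] := iet_cover (iter_stable n (@iet_map_stable _ _ T) zI).
rewrite iterS (iet_mapE za) mulSn.
by rewrite (_ : _ - z = trans T a + (iter n f z - z)); [exact: quad_leD|lra].
Qed.

Lemma quad_le_iter_int D z k : (forall a, quad_le d D (trans T a)) ->
  lft T <= z < rgt T -> quad_le d (`|k| * D) (iter_int T k z - z).
Proof.
move=> transD zI; case: k => m; first exact: quad_le_iter.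
have wI := iter_stable m.+1 (@iet_inv_stable _ _ T) zI.
have := quad_leN (quad_le_iter m.+1 transD wI); rewrite opprB.
by rewrite (iter_cancel (@iet_inv_stable _ _ T) (@iet_invK _ _ T))// subnn.
Qed.

Lemma quad_le_bound : Zsqrt d (rgt T) -> (forall a, Zsqrt d (sep T a)) ->
  (forall a, Zsqrt d (trans T a)) ->
  exists D, [/\ (0 < D)%N, quad_le d D (rgt T), forall a, quad_le d D (sep T a) &
    forall a, quad_le d D (trans T a)].
Proof.
move=> /Zsqrt_quad_le[K rK] sepZ transZ.
have /fin_all_exists[S sS] : forall a, exists K, quad_le d K (sep T a).
  by move=> a; exact: Zsqrt_quad_le.
have /fin_all_exists[N tN] : forall a, exists K, quad_le d K (trans T a).
  by move=> a; exact: Zsqrt_quad_le.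
exists (K + \max_a S a + \max_a N a).+1; split=> // [|a|a].
- by apply: quad_leW rK; rewrite -addnA -addnS leq_addr.
- by apply: quad_leW (sS a); rewrite (leq_trans (leq_bigmax a))//; lia.
- by apply: quad_leW (tN a); rewrite (leq_trans (leq_bigmax a))//; lia.
Qed.

End Dynamics.

(** Separation holds since [T^n z - z] is nonzero with coefficients at most [n D]. For the local
    property, the least room [L i] on the left and [U j] on the right along the orbit have a
    positive sum with coefficients at most [(n + 2) D]; so one side has room [c/n]. *)
Lemma iet_translation_dynamics (R : realType) (d : nat) (A : finType) (T : iet R A) :
  (2 <= d)%N -> squarefree d -> iet_minimal T ->
  (forall a, Zsqrt d (sep T a)) -> (forall a, Zsqrt d (trans T a)) ->
  exists c, translation_dynamics (lft T) (rgt T) c (iet_map T).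
Proof.
move=> d2 dsf Tmin sepZ transZ.
have rgtZ := rgt_Zsqrt Tmin sepZ transZ.
have [D [D0 rD sD tD]] := quad_le_bound rgtZ sepZ transZ.
have muD a : quad_le d D (mu T a) by have [->//|[b <-]] := mu_next T a.
pose s : R := 1 + Num.sqrt d%:R.
have s0 : 0 < s by rewrite ltr_wpDr ?sqrtr_ge0.
have DR : (0 : R) < D%:R by rewrite ltr0n.
(* The factor 6 is 3, from [(n + 2) D <= 3 n D], times 2, for sharing the sum between two sides. *)
pose c := (6 * D%:R * s)^-1.
have c0 : 0 < c by rewrite invr_gt0 !mulr_gt0.
have lower K z n : quad_le d K z -> z != 0 -> (0 < n)%N -> (K <= 3 * (n * D))%N ->
    2 * (c / n%:R) <= `|z|.
  move=> Kz z0 n0 Kn; have nR : (0 : R) < n%:R by rewrite ltr0n.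
  have := quad_le_norm d2 dsf (quad_leW Kn Kz) z0; rewrite -/s !natrM => ge1.
  have -> : 2 * (c / n%:R) = (3 * (n%:R * D%:R) * s)^-1.
    by rewrite /c; field; rewrite !gt_eqF.
  by rewrite -div1r ler_pdivrMr// !mulr_gt0.
exists c; split=> //; [exact: lft_lt_rgt|exact: iet_map_stable| |]; last first.
  move=> z n zI n0; apply: le_trans (lower (n * D)%N _ n _ _ _ _) => //.
  - by rewrite ler_peMl ?divr_ge0 ?ler1n// ltW.
  - exact: quad_le_iter.
  - by rewrite subr_eq0; apply/eqP; exact: iet_minimal_aperiodic.
  - by rewrite leq_pmull.
move=> z n zI n0; have zkI k := iter_stable k (@iet_map_stable _ _ T) zI.
have /choice[al alP] := fun k => iet_cover (zkI k).
pose zk k := iter k (iet_map T) z.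
pose L (k : 'I_n) := zk k - sep T (al k); pose U (k : 'I_n) := mu T (al k) - zk k.
pose k0 := Ordinal n0.
case: (@arg_minP _ _ _ k0 predT L isT) => i _ i_min.
case: (@arg_minP _ _ _ k0 predT U isT) => j _ j_min.
have Li k : L i <= L k by exact: i_min.
have Uj k : U j <= U k by exact: j_min.
have tr y : z - L i <= y < z + U j -> forall k, (k <= n)%N -> iter k (iet_map T) y = zk k + (y - z).
  move=> /andP[yl yu]; elim=> [|k IH] kn; first by rewrite /zk /=; lra.
  have Lk : L i <= zk k - sep T (al k) := Li (Ordinal kn).
  have Uk : U j <= mu T (al k) - zk k := Uj (Ordinal kn).
  rewrite /zk !iterS IH ?(ltnW kn)// (iet_mapE (alP k)) (@iet_mapE _ _ _ (al k)).
    by rewrite /zk; lra.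
  by rewrite -/(zk k); apply/andP; split; lra.
have LU : 2 * (c / n%:R) <= L i + U j.
  have zi := alP i; have zj := alP j.
  have LU0 : 0 < L i + U j.
    by move: zi zj => /andP[? ?] /andP[? ?]; rewrite /L /U /zk; lra.
  rewrite -[leRHS]gtr0_norm//; apply: (lower (n * D + D + D)%N) => //.
  - rewrite (_ : L i + U j = zk i - zk j - sep T (al i) + mu T (al j)); last first.
      by rewrite /L /U; lra.
    apply: quad_leD => //; apply: quad_leB => //.
    have [ij|/ltnW ij] := leqP i j.
      rewrite -opprB; apply: quad_leN; rewrite /zk -(subnK ij) iterD.
      apply: quad_leW (quad_le_iter _ tD (zkI i)).
      by rewrite leq_mul2r (leq_trans (leq_subr _ _)) ?orbT// ltnW.
    rewrite /zk -(subnK ij) iterD.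
    apply: quad_leW (quad_le_iter _ tD (zkI j)).
    by rewrite leq_mul2r (leq_trans (leq_subr _ _)) ?orbT// ltnW.
  - by rewrite gt_eqF.
  - by rewrite -addnA mulSn leq_add2l mul2n -addnn leq_add// leq_pmull.
have cn0 : 0 < c / n%:R by rewrite divr_gt0// ltr0n.
have lL : lft T <= z - L i.
  have L0 : L i <= z - sep T (al 0%N) := Li k0.
  by have := lft_le_sep T (al 0%N); lra.
have Ur : z + U j <= rgt T.
  have U0 : U j <= mu T (al 0%N) - z := Uj k0.
  by have := mu_le_rgt T (al 0%N); lra.
case/andP: (alP i) => Li1 _; case/andP: (alP j) => _ Uj1.
have Li0 : 0 <= L i by rewrite subr_ge0.
have Uj0 : 0 <= U j by rewrite subr_ge0 ltW.
have [cL|Lc] := leP (c / n%:R) (L i).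
  exists (z - c / n%:R); split; [lra|lra|move=> y /andP[y1 y2]; split].
    by rewrite ltr_norml; apply/andP; split; lra.
  by apply: tr; apply/andP; split; lra.
exists z; split; [by case/andP: zI|lra|move=> y /andP[y1 y2]; split].
  by rewrite ltr_norml; apply/andP; split; lra.
by apply: tr; apply/andP; split; lra.
Qed.

(** * Division points and the bounds on the reduced complexity *)

Lemma min_nat_le (P : set nat) n : P n -> (min_nat P <= n)%N.
Proof.
move=> Pn.
have /ex_minnP[m /asboolP Pm m_min] : exists m, `[< P m >] by exists n; apply/asboolP.
have [_ min_le] : [set n | P n /\ forall m, P m -> (n <= m)%N] (min_nat P).
  by apply: xgetPex; exists m; split=> // k /asboolP; exact: m_min.
exact: min_le.
Qed.

(** The forward hit is counted from [T z], as [rho_plus] ranges over positive times; this gives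
    [-n <= k <= m]. *)
Lemma Eset_abs_le (R : realType) (A : finType) (T : iet R A) (u v z : R) k m n :
  Eset T u v z k -> u < iter m (iet_map T) (iet_map T z) < v ->
  u < iter n (iet_inv T) z < v -> (`|k| <= m + n + 1)%N.
Proof.
move=> /= /andP[kge klt] hitm hitn.
have rp : (rho_plus T u v z <= m.+1)%N.
  by apply: min_nat_le; split=> //; rewrite in_itv /= -iterS iterSr.
have rm : (rho_minus T u v z <= n)%N.
  by apply: min_nat_le => /=; case: n hitn => [|n] hitn; rewrite in_itv.
by move: kge klt rp rm; clear; lia.
Qed.

(** A division point is [T^k] of a separation point with [|k| <= m + n + 1], where [m] and [n] are
    hitting times of order [1/(v - u)]; its coefficients are at most [(m + n + 2) D]. *)
Lemma Div_complexity_le (R : realType) (d : nat) (A : finType) (T : iet R A) :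
  (2 <= d)%N -> squarefree d -> iet_minimal T ->
  (forall a, Zsqrt d (sep T a)) -> (forall a, Zsqrt d (trans T a)) ->
  exists2 C : R, 0 < C & forall u v w, lft T <= u -> u < v -> v <= rgt T ->
    (Div T u v `|` [set rgt T]) w ->
    exists2 K, quad_le d K w & (v - u) * K%:R <= C.
Proof.
move=> d2 dsf Tmin sepZ transZ.
have [c fT] := iet_translation_dynamics d2 dsf Tmin sepZ transZ.
have fS := @iet_map_stable _ _ T; have gS := @iet_inv_stable _ _ T.
have fK := @iet_mapK _ _ T; have gK := @iet_invK _ _ T.
have gT := translation_dynamics_inverse fT gS fK gK.
have dense := fun x a b => @iet_minimal_hit _ _ T x a b Tmin.
have [C1 C1_gt0 hit_f] := hitting_time_le fT gS fK gK dense.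
have [C2 C2_gt0 hit_g] : exists2 C : R, 0 < C & forall x a b,
    lft T <= x < rgt T -> lft T <= a -> a < b -> b <= rgt T ->
    exists2 m, a < iter m (iet_inv T) x < b & m%:R * (b - a) <= C.
  apply: (hitting_time_le gT fS gK fK) => x a b xI la ab br.
  by have [m hit] := dense x a b xI la ab br; exists m; rewrite or_comm.
have [D [D0 rD sD tD]] := quad_le_bound (rgt_Zsqrt Tmin sepZ transZ) sepZ transZ.
have lr := lft_lt_rgt T.
have DR : (0 : R) < D%:R by rewrite ltr0n.
(* The last term pays for the 2 in [m + n + 2], as [v - u <= rgt - lft], and covers [w = rgt]. *)
exists (D%:R * (C1 + C2 + 2 * (rgt T - lft T))) => [|u v w lu uv vr].
  by rewrite mulr_gt0//; lra.
case=> [[a _ [k kE <-]]|->]; last first.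
  by exists D => //; rewrite mulrC ler_wpM2l ?ltW//; lra.
have aI := sep_in_dom T a.
have [m hitm mC] := hit_f _ u v (fS _ aI) lu uv vr.
have [n hitn nC] := hit_g _ u v aI lu uv vr.
exists ((m + n + 2) * D)%N.
  rewrite -[iter_int _ _ _](subrK (sep T a)) addrC (_ : _ * D = D + (m + n + 1) * D)%N.
    apply: quad_leD => //; apply: quad_leW (quad_le_iter_int k tD aI).
    by rewrite leq_mul2r (Eset_abs_le kE hitm hitn) orbT.
  by clear; lia.
rewrite natrM mulrA mulrC; apply: ler_wpM2l; first exact: ltW.
by rewrite 2!natrD; lra.
Qed.

Theorem theorem5p7 (R : realType) (d : nat) (hd2 : (2 <= d)%N)
    (hdsf : squarefree d) (A : finType) (T : iet R A)
    (hmin : iet_minimal T)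
    (hl : Zsqrt d (lft T))
    (hsep : forall a : A, Zsqrt d (sep T a))
    (htrans : forall a : A, Zsqrt d (trans T a)) :
  exists c C : R, [/\ 0 < c, c <= C &
    forall u v : R, admissible T u v ->
      c <= reduced_complexity d `[u, v[ <= C].
Proof.
have [C C0 upper] := Div_complexity_le hd2 hdsf hmin hsep htrans.
pose s : R := 1 + Num.sqrt d%:R.
have s0 : 0 < s by rewrite ltr_wpDr ?sqrtr_ge0.
(* The factor 2 comes from the coefficients of [v - u], at most the sum of the two values of [Psi]
   and so twice their maximum. *)
pose c := (2 * s)^-1; have c0 : 0 < c by rewrite invr_gt0 mulr_gt0.
(* The maximum secures [c <= C] even if no interval is admissible. *)
exists c, (Num.max c C); split=> // [|u v [lu uv vr uD vD]]; first by rewrite le_max lexx.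
have uv0 : 0 < v - u by rewrite subr_gt0.
rewrite reduced_complexity_itvco//; apply/andP; split; last first.
  rewrite le_max; apply/orP; right.
  have [K uK uC] := upper _ _ _ lu uv vr uD; have [L vL vC] := upper _ _ _ lu uv vr vD.
  have uvW := ltW uv0; rewrite maxr_pMr// ge_max.
  by rewrite (le_trans _ uC) ?(le_trans _ vC)// ler_wpM2l//; exact: Psi_le.
have Z w : (Div T u v `|` [set rgt T]) w -> Zsqrt d w.
  by move=> /(upper _ _ _ lu uv vr)[K [p [-> _ _]] _]; exact: imageP.
have [K uK ->] := quad_le_Psi hd2 hdsf (Z _ uD).
have [L vL ->] := quad_le_Psi hd2 hdsf (Z _ vD).
have := quad_le_norm hd2 hdsf (quad_leB vL uK) (lt0r_neq0 uv0).
rewrite gtr0_norm// -/s natrD => norm_ge.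
have KM : K%:R <= Num.max K%:R L%:R :> R by rewrite le_max lexx.
have LM : L%:R <= Num.max K%:R L%:R :> R by rewrite le_max lexx orbT.
rewrite /c -div1r ler_pdivrMr ?mulr_gt0// (le_trans norm_ge)// -mulrA ler_pM2l//.
by rewrite [_ * (2 * s)]mulrA ler_pM2r//; lra.
Qed.
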